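(* Let $K$ be one of the real algebras $\mathbb{R}, \mathbb{C}, \mathbb{H}, \mathbb{O}, \mathbb{S}, \ldots$ obtained by iterating the classical Cayley–Dickson doubling procedure starting from the real numbers. Let $Y$ be a compact Hausdorff space, let $g : Y \to Y$ be a continuous map, and let $C(Y)$ be the ring of continuous functions $Y \to K$. Let $\delta_{\sigma(g)} : C(Y)\to C(Y)$ be the map $\delta_{\sigma(g)}(f) = f\circ g - f$. If the action of $g$ on $Y$ is minimal and the topology on $Y$ is non-discrete, then the non-associative differential polynomial ring $D = C(Y)[X; \mathrm{id}_{C(Y)}, \delta_{\sigma(g)}]$ is simple. In that case, $Z(D) = \mathbb{C}$ if $K = \mathbb{C}$, and $Z(D) = \mathbb{R}$ otherwise.
   Context: Rings are unital but not necessarily associative. Ideals are two-sided; a ring is simple if $\{0\}$ and the ring itself are its only ideals. The center $Z(A)$ of a ring $A$ is the set of elements $r\in A$ that commute with all elements of $A$ and satisfy $(r,s,t)=(s,r,t)=(s,t,r)=0$ for all $s,t\in A$, where $(r,s,t)=(rs)t-r(st)$. $C(Y)$ has pointwise operations, and $K$ carries its usual (Euclidean) topology. Elements of $K$ are identified with constant functions in $C(Y)$, and elements of $C(Y)$ with degree-zero polynomials in $D$; the equalities $Z(D)=\mathbb{C}$ and $Z(D)=\mathbb{R}$ are understood via these identifications. A closed subspace $Z$ of $Y$ is $g$-invariant if $g(Z)\subseteq Z$. The action of $g$ on $Y$ is minimal if $\emptyset$ and $Y$ are the only ($g$-invariant closed) $g$-invariant subspaces of $Y$. For a ring $R$ and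 an additive map $\delta:R\to R$ with $\delta(1)=0$, $R[X;\mathrm{id}_R,\delta]$ is the set of formal polynomials $\sum_i r_i X^i$ ($r_i\in R$) with the usual addition and with multiplication the biadditive extension of $aX^m \cdot bX^n = \sum_{i=0}^m \binom{m}{i} a\,\delta^{m-i}(b) X^{i+n}$, for $a,b\in R$, $m,n\in\mathbb{N}$. *)

(* Defs.v *)
From HB Require Import structures.
From mathcomp Require Import all_boot all_order all_algebra.
From mathcomp Require Import all_classical all_reals.
From mathcomp Require Import topology normedtype.

Set Implicit Arguments.
Unset Strict Implicit.
Unset Printing Implicit Defensive.

Import Order.TTheory GRing.Theory Num.Theory.
Import numFieldNormedType.Exports.

Local Open Scope classical_set_scope.
Local Open Scope ring_scope.

Reserved Notation "x ** y" (at level 40, left associativity).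

HB.mixin Record Zmodule_isNaRing A & GRing.Zmodule A := {
  naone : A;
  namul : A -> A -> A;
  namul1l : left_id naone namul;
  namul1r : right_id naone namul;
  namulDl : left_distributive namul +%R;
  namulDr : right_distributive namul +%R
}.

#[short(type="naRingType")]
HB.structure Definition NaRing := {A of Zmodule_isNaRing A & GRing.Zmodule A}.

Arguments naone {_}.

Notation "x ** y" := (namul x y) : ring_scope.

Section NaRingTheory.
Context (A : naRingType).
Implicit Types (x y : A) (I : set A).

Lemma namul0l x : 0 ** x = 0.
Proof. by apply: (addrI (0 ** x)); rewrite -namulDl !addr0. Qed.

Lemma namul0r x : x ** 0 = 0.
Proof. by apply: (addrI (x ** 0)); rewrite -namulDr !addr0. Qed.

Lemma namulNl x y : (- x) ** y = - (x ** y).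
Proof. by apply: (addrI (x ** y)); rewrite -namulDl !subrr namul0l. Qed.

Lemma namulNr x y : x ** (- y) = - (x ** y).
Proof. by apply: (addrI (x ** y)); rewrite -namulDr !subrr namul0r. Qed.

Definition associator x y z : A := (x ** y) ** z - x ** (y ** z).

Definition nacenter : set A := [set r |
  (forall s, r ** s = s ** r) /\
  (forall s t, [/\ associator r s t = 0,
                   associator s r t = 0 & associator s t r = 0])].

Definition naideal I : Prop :=
  [/\ I 0,
      forall x y, I x -> I y -> I (x - y),
      forall a x, I x -> I (a ** x) &
      forall a x, I x -> I (x ** a)].

Definition nasimple : Prop :=
  forall I, naideal I -> I = [set 0] \/ I = setT.

End NaRingTheory.

Arguments nacenter : clear implicits.
Arguments nasimple : clear implicits.

HB.mixin Record NaRing_isTopological A & TopologicalZmodule A & NaRing A := {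
  namul_continuous : continuous (fun z : A * A => z.1 ** z.2)
}.

#[short(type="topNaRingType")]
HB.structure Definition TopNaRing :=
  {A of TopologicalZmodule A & NaRing A & NaRing_isTopological A}.

HB.mixin Record isStarAlgebra (R : realType) A
    & NormedModule R A & TopNaRing A := {
  star : A -> A;
  starD : {morph star : x y / x + y};
  starZ : forall k : R, {morph star : x / k *: x};
  starK : involutive star;
  starM : forall x y, star (x ** y) = star y ** star x;
  star_continuous : continuous star;
  namulZl : forall (k : R) (x y : A), (k *: x) ** y = k *: (x ** y);
  namulZr : forall (k : R) (x y : A), x ** (k *: y) = k *: (x ** y)
}.

(* The norm is there for its topology: the norms obtained below are maximum
   norms (not multiplicative), which induce the Euclidean topology. *)
#[short(type="starAlgType")]
HB.structure Definition StarAlgebra (R : realType) :=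
  {A of NormedModule R A & TopNaRing A & isStarAlgebra R A}.

Section RealStarAlgebra.
Context (R : realType).

HB.instance Definition _ := @Zmodule_isNaRing.Build R^o 1 *%R
  (@mul1r R) (@mulr1 R) (@mulrDl R) (@mulrDr R).

Let real_mul_continuous : continuous (fun z : R^o * R^o => z.1 ** z.2).
Proof. exact: mul_continuous. Qed.

HB.instance Definition _ :=
  @NaRing_isTopological.Build R^o real_mul_continuous.

Let real_starM (x y : R^o) : id (x ** y) = id y ** id x.
Proof. exact: mulrC. Qed.

Let real_mulZl (k : R) (x y : R^o) : (k *: x) ** y = k *: (x ** y).
Proof. exact/esym/mulrA. Qed.

Let real_mulZr (k : R) (x y : R^o) : x ** (k *: y) = k *: (x ** y).
Proof. exact: mulrCA. Qed.

HB.instance Definition _ := @isStarAlgebra.Build R R^o idfun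
  (fun _ _ => erefl) (fun _ _ => erefl) (fun _ => erefl) real_starM
  (fun _ _ => id) real_mulZl real_mulZr.

End RealStarAlgebra.

Definition cddouble (A : Type) : Type := (A * A)%type.

Section Doubling.
Context (R : realType) (A : starAlgType R).
Local Notation dbl := (cddouble A).

HB.instance Definition _ := NormedModule.copy dbl (A * A)%type.

Definition dbl_one : dbl := (naone, 0).

Definition dbl_mul (x y : dbl) : dbl :=
  (x.1 ** y.1 - star y.2 ** x.2, y.2 ** x.1 + x.2 ** star y.1).

Definition dbl_star (x : dbl) : dbl := (star x.1, - x.2).

Let star0 : star (0 : A) = 0.
Proof. by apply: (addrI (star 0)); rewrite -starD !addr0. Qed.

Let starN (x : A) : star (- x) = - star x.
Proof. by apply: (addrI (star x)); rewrite -starD !subrr star0. Qed.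

Let star1 : star (naone : A) = naone.
Proof.
by rewrite -[LHS]namul1r -[X in _ ** X]starK -starM namul1r starK.
Qed.

Let dbl_mul1l : left_id dbl_one dbl_mul.
Proof.
move=> [a b]; rewrite /dbl_mul /= namul1l namul0r namul0l namul1r.
by rewrite subr0 addr0.
Qed.

Let dbl_mul1r : right_id dbl_one dbl_mul.
Proof.
move=> [a b]; rewrite /dbl_mul /= star1 star0 !namul1r !namul0l.
by rewrite subr0 add0r.
Qed.

Let dbl_mulDl : left_distributive dbl_mul +%R.
Proof.
move=> [a b] [c d] [e f]; rewrite /dbl_mul /=; congr (_, _) => /=.
  by rewrite namulDl namulDr opprD addrACA.
by rewrite namulDl namulDr addrACA.
Qed.

Let dbl_mulDr : right_distributive dbl_mul +%R.
Proof.
move=> [a b] [c d] [e f]; rewrite /dbl_mul /=; congr (_, _) => /=.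
  by rewrite starD namulDl namulDr opprD addrACA.
by rewrite starD namulDl namulDr addrACA.
Qed.

HB.instance Definition _ := @Zmodule_isNaRing.Build dbl
  dbl_one dbl_mul dbl_mul1l dbl_mul1r dbl_mulDl dbl_mulDr.

Let cvg_namul (T : Type) (F : set_system T) (FF : Filter F)
    (f h : T -> A) (a b : A) :
  f @ F --> a -> h @ F --> b -> (fun x => f x ** h x) @ F --> a ** b.
Proof.
move=> fa hb; apply: (@continuous2_cvg T A A A F FF f h namul a b _ fa hb).
exact: (@namul_continuous A (a, b)).
Qed.

Let cvg_star (T : Type) (F : set_system T) (FF : Filter F)
    (f : T -> A) (a : A) : f @ F --> a -> (fun x => star (f x)) @ F --> star a.
Proof. by move=> fa; apply: continuous_cvg fa; exact: star_continuous. Qed.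

Let dbl_mul_continuous : continuous (fun z : dbl * dbl => z.1 ** z.2).
Proof.
move=> z.
have c1 : (fun x : dbl * dbl => x.1) @ z --> z.1 by exact: cvg_fst.
have c2 : (fun x : dbl * dbl => x.2) @ z --> z.2 by exact: cvg_snd.
have c11 : (fun x : dbl * dbl => x.1.1) @ z --> z.1.1.
  by apply: (cvg_comp _ _ c1); exact: cvg_fst.
have c12 : (fun x : dbl * dbl => x.1.2) @ z --> z.1.2.
  by apply: (cvg_comp _ _ c1); exact: cvg_snd.
have c21 : (fun x : dbl * dbl => x.2.1) @ z --> z.2.1.
  by apply: (cvg_comp _ _ c2); exact: cvg_fst.
have c22 : (fun x : dbl * dbl => x.2.2) @ z --> z.2.2.
  by apply: (cvg_comp _ _ c2); exact: cvg_snd.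
apply: cvg_pair.
  apply: cvgB; first exact: cvg_namul c11 c21.
  exact: (cvg_namul _ (cvg_star _ c22) c12).
apply: cvgD; first exact: cvg_namul c22 c11.
exact: (cvg_namul _ c12 (cvg_star _ c21)).
Qed.

HB.instance Definition _ :=
  @NaRing_isTopological.Build dbl dbl_mul_continuous.

Let dbl_starD : {morph dbl_star : x y / x + y}.
Proof.
by move=> [a b] [c d]; rewrite /dbl_star /= starD opprD.
Qed.

Let dbl_starZ (k : R) : {morph dbl_star : x / k *: x}.
Proof. by move=> [a b]; rewrite /dbl_star /= starZ -scalerN. Qed.

Let dbl_starK : involutive dbl_star.
Proof. by move=> [a b]; rewrite /dbl_star /= starK opprK. Qed.

Let dbl_starM (x y : dbl) : dbl_star (x ** y) = dbl_star y ** dbl_star x.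
Proof.
case: x y => [a b] [c d]; congr (_, _) => /=.
  by rewrite starD !starN !starM starK namulNl namulNr opprK.
by rewrite starK !namulNl opprD addrC.
Qed.

Let dbl_star_continuous : continuous dbl_star.
Proof.
move=> z; apply: cvg_pair; first by apply: cvg_star; exact: cvg_fst.
by apply: cvgN; exact: cvg_snd.
Qed.

Let dbl_mulZl (k : R) (x y : dbl) : (k *: x) ** y = k *: (x ** y).
Proof.
case: x y => [a b] [c d]; congr (_, _) => /=.
  by rewrite namulZl namulZr scalerBr.
by rewrite namulZl namulZr scalerDr.
Qed.

Let dbl_mulZr (k : R) (x y : dbl) : x ** (k *: y) = k *: (x ** y).
Proof.
case: x y => [a b] [c d]; congr (_, _) => /=.
  by rewrite starZ namulZl namulZr scalerBr.
by rewrite starZ namulZl namulZr scalerDr.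
Qed.

HB.instance Definition _ := @isStarAlgebra.Build R dbl dbl_star
  dbl_starD dbl_starZ dbl_starK dbl_starM dbl_star_continuous
  dbl_mulZl dbl_mulZr.

End Doubling.

(* n = 0, 1, 2, 3, 4 gives the reals, complex numbers, quaternions, octonions
   and sedenions. *)
Fixpoint cayley_dickson (R : realType) (n : nat) : starAlgType R :=
  if n is m.+1 then cddouble (cayley_dickson R m) : starAlgType R
  else R^o : starAlgType R.

Section ContinuousZmodule.
Context (Y : topologicalType) (A : topologicalZmodType).
Local Notation CY := (continuousType Y A).
Implicit Types f h : CY.

Let add_cts f h : continuous (fun y => f y + h y).
Proof.
move=> y; apply: (@continuous2_cvg _ _ _ _ _ _ f h +%R).
- exact: (@add_continuous A (f y, h y)).
- exact: cts_fun.
- exact: cts_fun.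
Qed.

Let opp_cts f : continuous (fun y => - f y).
Proof.
move=> y; apply: continuous_cvg; first exact: opp_continuous.
exact: cts_fun.
Qed.

Definition cts_zero : CY := cst 0.
Definition cts_add f h : CY := mkcts (@add_cts f h).
Definition cts_opp f : CY := mkcts (@opp_cts f).

Let cts_addA : associative cts_add.
Proof. by move=> f h k; apply/continuousEP => y; exact: addrA. Qed.

Let cts_addC : commutative cts_add.
Proof. by move=> f h; apply/continuousEP => y; exact: addrC. Qed.

Let cts_add0 : left_id cts_zero cts_add.
Proof. by move=> f; apply/continuousEP => y; exact: add0r. Qed.

Let cts_addN : left_inverse cts_zero cts_opp cts_add.
Proof. by move=> f; apply/continuousEP => y; exact: addNr. Qed.

HB.instance Definition _ :=
  GRing.isZmodule.Build CY cts_addA cts_addC cts_add0 cts_addN.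

End ContinuousZmodule.

Section ContinuousNaRing.
Context (Y : topologicalType) (A : topNaRingType).
Local Notation CY := (continuousType Y A).
Implicit Types f h : CY.

Let mul_cts f h : continuous (fun y => f y ** h y).
Proof.
move=> y; apply: (@continuous2_cvg _ _ _ _ _ _ f h namul).
- exact: (@namul_continuous A (f y, h y)).
- exact: cts_fun.
- exact: cts_fun.
Qed.

Definition cts_one : CY := cst naone.
Definition cts_mul f h : CY := mkcts (@mul_cts f h).

Let cts_mul1l : left_id cts_one cts_mul.
Proof. by move=> f; apply/continuousEP => y; exact: namul1l. Qed.

Let cts_mul1r : right_id cts_one cts_mul.
Proof. by move=> f; apply/continuousEP => y; exact: namul1r. Qed.

Let cts_mulDl : left_distributive cts_mul +%R.
Proof. by move=> f h k; apply/continuousEP => y; exact: namulDl. Qed.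

Let cts_mulDr : right_distributive cts_mul +%R.
Proof. by move=> f h k; apply/continuousEP => y; exact: namulDr. Qed.

HB.instance Definition _ := @Zmodule_isNaRing.Build CY
  cts_one cts_mul cts_mul1l cts_mul1r cts_mulDl cts_mulDr.

End ContinuousNaRing.

Record unital_delta (A : naRingType) := UnitalDelta {
  delta_fun :> {additive A -> A};
  delta_one : delta_fun naone = 0
}.

(* [fpoly A]: the formal polynomials sum_i r_i X^i, given by their
   coefficients. *)
Record fpoly (A : zmodType) := FPoly {
  fcoef :> nat -> A;
  fcoef_bounded : exists N, forall i, (N <= i)%N -> fcoef i = 0
}.

Section FPoly.
Context (A : zmodType).
Local Notation fpoly := (fpoly A).
Implicit Types p q : fpoly.

Lemma fpolyP p q : p =1 q <-> p = q.
Proof.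
split=> [|->//]; case: p q => [p hp] [q hq] /= /funext pq.
by rewrite -pq in hq *; congr FPoly; exact: Prop_irrelevance.
Qed.

HB.instance Definition _ := gen_eqMixin fpoly.
HB.instance Definition _ := gen_choiceMixin fpoly.

Let zero_bounded : exists N, forall i, (N <= i)%N -> (fun=> 0 : A) i = 0.
Proof. by exists 0%N. Qed.

Let add_bounded p q :
  exists N, forall i, (N <= i)%N -> (fun j => p j + q j) i = 0.
Proof.
have [M pM] := fcoef_bounded p; have [N qN] := fcoef_bounded q.
by exists (maxn M N) => i; rewrite geq_max => /andP[/pM -> /qN ->]; rewrite addr0.
Qed.

Let opp_bounded p :
  exists N, forall i, (N <= i)%N -> (fun j => - p j) i = 0.
Proof.
have [M pM] := fcoef_bounded p.
by exists M => i /pM ->; rewrite oppr0.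
Qed.

Definition fzero : fpoly := FPoly zero_bounded.
Definition fadd p q : fpoly := FPoly (add_bounded p q).
Definition fopp p : fpoly := FPoly (opp_bounded p).

Let faddA : associative fadd.
Proof. by move=> p q r; apply/fpolyP => i; exact: addrA. Qed.

Let faddC : commutative fadd.
Proof. by move=> p q; apply/fpolyP => i; exact: addrC. Qed.

Let fadd0 : left_id fzero fadd.
Proof. by move=> p; apply/fpolyP => i; exact: add0r. Qed.

Let faddN : left_inverse fzero fopp fadd.
Proof. by move=> p; apply/fpolyP => i; exact: addNr. Qed.

HB.instance Definition _ :=
  GRing.isZmodule.Build fpoly faddA faddC fadd0 faddN.

Lemma fcoefD p q i : (p + q) i = p i + q i.
Proof. by []. Qed.

Lemma fcoef_sum (I : Type) (r : seq I) (P : pred I) (F : I -> fpoly) i :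
  (\sum_(j <- r | P j) F j) i = \sum_(j <- r | P j) F j i.
Proof. by elim/big_rec2: _ => // j x y _ <-. Qed.

Let fsize_ex p : exists N, `[< forall i, (N <= i)%N -> p i = 0 >].
Proof. by have [N pN] := fcoef_bounded p; exists N; apply/asboolP. Qed.

(* The degree plus one, and 0 for the zero polynomial. *)
Definition fsize p : nat := ex_minn (fsize_ex p).

Lemma fsizeP p i : (fsize p <= i)%N -> p i = 0.
Proof. by rewrite /fsize; case: ex_minnP => m /asboolP + _; exact. Qed.

Let mono_bounded (a : A) (k : nat) :
  exists N, forall i, (N <= i)%N -> (fun j => if j == k then a else 0) i = 0.
Proof. by exists k.+1 => i; case: eqP => // ->; rewrite ltnn. Qed.

(* The monomial a X^k. *)
Definition fmono (a : A) (k : nat) : fpoly := FPoly (mono_bounded a k).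

Lemma fsize_mono a k : (fsize (fmono a k) <= k.+1)%N.
Proof.
rewrite /fsize; case: ex_minnP => m _; apply; apply/asboolP => i ki /=.
by case: eqP ki => // ->; rewrite ltnn.
Qed.

Lemma fmonoD a b k : fmono (a + b) k = fmono a k + fmono b k.
Proof.
by apply/fpolyP => i; rewrite fcoefD /=; case: ifP; rewrite ?addr0.
Qed.

Lemma fmono0 k : fmono 0 k = 0.
Proof. by apply/fpolyP => i /=; case: ifP. Qed.

Lemma fpoly_sum_mono p N : (fsize p <= N)%N ->
  \sum_(n < N) fmono (p n) n = p.
Proof.
move=> pN; apply/fpolyP => i; rewrite fcoef_sum.
have [iN|Ni] := ltnP i N.
  rewrite (bigD1 (Ordinal iN)) //= eqxx big1 ?addr0 // => j.
  by case: ifP => // /eqP ij /eqP[]; apply/val_inj.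
rewrite (fsizeP (leq_trans pN Ni)) big1 // => j _ /=.
by case: ifP => // /eqP ij; move: (ltn_ord j); rewrite -ij ltnNge Ni.
Qed.

End FPoly.

(* A[X; id_A, delta]. *)
Definition diffpoly (A : naRingType) (delta : unital_delta A) : Type := fpoly A.

Section DiffPoly.
Context (A : naRingType) (delta : unital_delta A).
Local Notation D := (diffpoly delta).
Implicit Types (p q : D) (a b : A).

HB.instance Definition _ := GRing.Zmodule.copy D (fpoly A).

(* a X^m . b X^n *)
Definition mono_mul a m b n : D :=
  \sum_(i < m.+1) fmono (a ** iter (m - i) delta b) (i + n) *+ 'C(m, i).

Definition dp_one : D := fmono naone 0.

Definition dp_mul p q : D :=
  \sum_(m < fsize p) \sum_(n < fsize q) mono_mul (p m) m (q n) n.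

Let iterD k a b : iter k delta (a + b) = iter k delta a + iter k delta b.
Proof. by elim: k => //= k ->; exact: raddfD. Qed.

Let mono_mulDl a b m c n :
  mono_mul (a + b) m c n = mono_mul a m c n + mono_mul b m c n.
Proof.
rewrite /mono_mul -big_split /=; apply: eq_bigr => i _.
by rewrite namulDl fmonoD mulrnDl.
Qed.

Let mono_mulDr a m b c n :
  mono_mul a m (b + c) n = mono_mul a m b n + mono_mul a m c n.
Proof.
rewrite /mono_mul -big_split /=; apply: eq_bigr => i _.
by rewrite iterD namulDr fmonoD mulrnDl.
Qed.

Let mono_mul0l m c n : mono_mul 0 m c n = 0.
Proof. by apply: (addrI (mono_mul 0 m c n)); rewrite -mono_mulDl !addr0. Qed.

Let mono_mul0r a m n : mono_mul a m 0 n = 0.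
Proof. by apply: (addrI (mono_mul a m 0 n)); rewrite -mono_mulDr !addr0. Qed.

Lemma dp_mulE M N p q : (fsize p <= M)%N -> (fsize q <= N)%N ->
  dp_mul p q = \sum_(m < M) \sum_(n < N) mono_mul (p m) m (q n) n.
Proof.
move=> pM qN.
rewrite /dp_mul (big_ord_widen M
  (fun m => \sum_(n < fsize q) mono_mul (p m) m (q n) n)) //.
rewrite big_mkcond; apply: eq_bigr => m _; case: ltnP => pm.
  rewrite (big_ord_widen N (fun n => mono_mul (p m) m (q n) n)) //.
  rewrite big_mkcond; apply: eq_bigr => n _; case: ltnP => // qn.
  by rewrite (fsizeP qn) mono_mul0r.
by rewrite (fsizeP pm) big1 // => n _; exact: mono_mul0l.
Qed.

Let fsize_one : (fsize (dp_one : fpoly A) <= 1)%N.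
Proof. exact: fsize_mono. Qed.

Let dp_mul1l : left_id dp_one dp_mul.
Proof.
move=> p; rewrite (dp_mulE fsize_one (leqnn _)) big_ord1 /=.
under eq_bigr => n _ do
  rewrite /mono_mul big_ord1 /= namul1l bin0 mulr1n add0n.
exact: fpoly_sum_mono.
Qed.

Let iter_one k : (0 < k)%N -> iter k delta naone = 0.
Proof.
case: k => // k _; elim: k => [|k IH]; first exact: delta_one.
by rewrite iterS IH raddf0.
Qed.

Let dp_mul1r : right_id dp_one dp_mul.
Proof.
move=> p; rewrite (dp_mulE (leqnn _) fsize_one).
rewrite -[RHS](fpoly_sum_mono (leqnn _)); apply: eq_bigr => m _.
rewrite big_ord1 /= /mono_mul big_ord_recr /= subnn /= namul1r binn addn0.
rewrite big1 ?add0r // => i _.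
by rewrite iter_one ?subn_gt0 // namul0r fmono0 mul0rn.
Qed.

Let dp_mulDl : left_distributive dp_mul +%R.
Proof.
move=> p q r; set M := maxn (fsize (p + q)) (maxn (fsize p) (fsize q)).
have h1 : (fsize (p + q)%R <= M)%N by exact: leq_maxl.
have h2 : (fsize p <= M)%N by rewrite !leq_max leqnn orbT.
have h3 : (fsize q <= M)%N by rewrite !leq_max leqnn !orbT.
rewrite (dp_mulE h1 (leqnn _)) (dp_mulE h2 (leqnn _)) (dp_mulE h3 (leqnn _)).
rewrite -big_split; apply: eq_bigr => m _ /=.
by rewrite -big_split; apply: eq_bigr => n _ /=; rewrite -mono_mulDl.
Qed.

Let dp_mulDr : right_distributive dp_mul +%R.
Proof.
move=> r p q; set M := maxn (fsize (p + q)) (maxn (fsize p) (fsize q)).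
have h1 : (fsize (p + q)%R <= M)%N by exact: leq_maxl.
have h2 : (fsize p <= M)%N by rewrite !leq_max leqnn orbT.
have h3 : (fsize q <= M)%N by rewrite !leq_max leqnn !orbT.
rewrite (dp_mulE (leqnn _) h1) (dp_mulE (leqnn _) h2) (dp_mulE (leqnn _) h3).
rewrite -big_split; apply: eq_bigr => m _ /=.
by rewrite -big_split; apply: eq_bigr => n _ /=; rewrite -mono_mulDr.
Qed.

HB.instance Definition _ := @Zmodule_isNaRing.Build D
  dp_one dp_mul dp_mul1l dp_mul1r dp_mulDl dp_mulDr.

Lemma dp_mul_mono a m b n :
  (fmono a m : D) ** (fmono b n : D) = mono_mul a m b n.
Proof.
rewrite [LHS](dp_mulE (fsize_mono a m) (fsize_mono b n)).
rewrite big_ord_recr big1 /= ?add0r; last first.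
  by move=> i _; rewrite big1 // => j _; rewrite ltn_eqF // mono_mul0l.
rewrite big_ord_recr big1 /= ?add0r ?eqxx // => i _.
by rewrite ltn_eqF // mono_mul0r.
Qed.

(* The embedding of A as the degree-zero polynomials. *)
Definition dp_const a : D := fmono a 0.

End DiffPoly.

Section DeltaSigma.
Context (Y : topologicalType) (A : topNaRingType) (g : continuousType Y Y).
Local Notation CY := (continuousType Y A).

Definition sigma (f : CY) : CY := f \o g.

Definition delta_sigma_fun (f : CY) : CY := sigma f - f.

Let delta_sigma_additive : nmod_morphism delta_sigma_fun.
Proof.
split=> [|f h]; apply/continuousEP => y; first exact: subrr.
transitivity (f (g y) + h (g y) - (f y + h y)); first by [].
by rewrite opprD; exact: addrACA.
Qed.

HB.instance Definition _ :=
  GRing.isNmodMorphism.Build CY CY delta_sigma_fun delta_sigma_additive.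

Let delta_sigma_one : delta_sigma_fun naone = 0.
Proof. by apply/continuousEP => y; exact: subrr. Qed.

Definition delta_sigma : unital_delta CY :=
  @UnitalDelta CY delta_sigma_fun delta_sigma_one.

End DeltaSigma.

Definition invariant_set (Y : Type) (g : Y -> Y) (Z : set Y) : Prop :=
  g @` Z `<=` Z.

Definition minimal_action (Y : topologicalType) (g : Y -> Y) : Prop :=
  forall Z : set Y, closed Z -> invariant_set g Z -> Z = set0 \/ Z = setT.

Definition discrete_space (Y : topologicalType) : Prop :=
  forall U : set Y, open U.

(* Main.v *)
Require Import Defs.
From mathcomp Require Import all_boot all_order all_algebra.
From mathcomp Require Import all_classical all_reals.
From mathcomp Require Import topology normedtype.
From mathcomp Require Import ring.

(** Write [A] for the ring of continuous functions [Y -> K] and [delta] for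
    [f |-> f \o g - f].

    Simplicity is obtained by the usual reduction to monic polynomials of least
    degree, which survives without associativity because it only multiplies by
    constants and by [X] ([dp_simple]). It rests on two properties of
    [(A, delta)].

    The first is that [A] has no proper nonzero [delta]-stable ideal
    ([minimal_delta_simple]). In every Cayley-Dickson algebra [x* x] is a
    nonnegative real that vanishes only for [x = 0] ([cd_star_mul]), so the
    argument for real-valued functions on a compact space applies: a proper
    ideal has a common zero ([proper_ideal_zero]). If the ideal is
    [delta]-stable, its common zeros form a closed [g]-invariant set, which by
    minimality is all of [Y].

    The second is that no nonzero constant multiple of [delta] is an inner map
    [a |-> a c - c a] ([minimal_delta_outer]). Inner maps vanish on real-valued
    functions. As [Y] is not discrete, minimality implies that [g] moves some
    point, and Urysohn's lemma gives a real-valued function on which [delta]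
    does not vanish there.

    The same two facts about coefficients, that commuting with [X] means having
    [g]-invariant coefficients and that commuting with real-valued functions
    excludes positive degree, reduce the center of the polynomial ring to the
    center of [K] ([minimal_center]), and this is computed from the doubling
    formula ([cd_center1], [cd_center_neq1]). *)

Set Implicit Arguments.
Unset Strict Implicit.
Unset Printing Implicit Defensive.

Import Order.TTheory GRing.Theory Num.Theory.
Import numFieldNormedType.Exports.

Local Open Scope classical_set_scope.
Local Open Scope ring_scope.

(** * Bilinearity in non-associative rings *)

Section NaRingBilinear.
Context (B : naRingType).
Implicit Types x y : B.

Lemma namul_sumr x (I : Type) (r : seq I) (P : pred I) (F : I -> B) :
  x ** (\sum_(i <- r | P i) F i) = \sum_(i <- r | P i) x ** F i.
Proof. exact: (big_morph (namul x) (namulDr x) (namul0r x)). Qed.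

Lemma namul_suml x (I : Type) (r : seq I) (P : pred I) (F : I -> B) :
  (\sum_(i <- r | P i) F i) ** x = \sum_(i <- r | P i) F i ** x.
Proof.
exact: (big_morph (namul^~ x) (fun y z => namulDl y z x) (namul0l x)).
Qed.

Lemma namulMnr x y n : x ** (y *+ n) = (x ** y) *+ n.
Proof. by elim: n => [|n IH]; rewrite ?mulr0n ?namul0r // !mulrS namulDr IH. Qed.

Lemma associatorDl x y z t :
  associator (x + y) z t = associator x z t + associator y z t.
Proof. by rewrite /associator !namulDl opprD addrACA. Qed.

Lemma associatorDm x y z t :
  associator x (y + z) t = associator x y t + associator x z t.
Proof. by rewrite /associator !(namulDr, namulDl) opprD addrACA. Qed.

Lemma associatorDr x y z t :
  associator x y (z + t) = associator x y z + associator x y t.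
Proof. by rewrite /associator !namulDr opprD addrACA. Qed.

End NaRingBilinear.

(** * Coefficients of products of differential polynomials *)

Section DiffPolyTheory.
Context (A : naRingType) (delta : unital_delta A).
Local Notation D := (diffpoly delta).
Local Notation C := (dp_const delta).
Implicit Types (p q : D) (a b c : A).

Lemma fcoefMn p k i : (p *+ k) i = (p i) *+ k.
Proof. by elim: k => // k IH; rewrite !mulrS fcoefD IH. Qed.

Lemma fcoefB p q i : (p - q) i = p i - q i.
Proof. by []. Qed.

Lemma iter_delta0 k : iter k delta 0 = 0.
Proof. by elim: k => //= k ->; exact: raddf0. Qed.

Lemma fcoef_sum_mono (F : nat -> A) N i :
  (\sum_(m < N) (fmono (F m) m : D)) i = if (i < N)%N then F i else 0.
Proof.
rewrite fcoef_sum; case: ltnP => [iN|Ni].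
  rewrite (bigD1 (Ordinal iN)) //= eqxx big1 ?addr0 // => j ij.
  by case: eqP => // e; case/eqP: ij; apply/val_inj.
rewrite big1 // => j _ /=; case: eqP => // e.
by have := ltn_ord j; rewrite -e ltnNge Ni.
Qed.

Lemma dp_mono_ind (P : D -> Prop) : (forall p q, P p -> P q -> P (p + q)) ->
  (forall a m, P (fmono a m)) -> forall p, P p.
Proof.
move=> PD Pm p; rewrite -[p](fpoly_sum_mono (leqnn _)).
by apply: (big_ind P) => //; rewrite -(fmono0 A 0%N).
Qed.

Lemma dp_Cmul_coef p a i : (C a ** p) i = a ** p i.
Proof.
rewrite [C a ** p](dp_mulE (fsize_mono a 0) (leqnn _)) big_ord1 /=.
rewrite /mono_mul; under eq_bigr do rewrite big_ord1 /= bin0 mulr1n add0n.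
rewrite (fcoef_sum_mono (fun m => a ** p m)).
by case: ltnP => // /fsizeP ->; rewrite namul0r.
Qed.

Lemma fsize_le p N : (forall i, (N <= i)%N -> p i = 0) -> (fsize p <= N)%N.
Proof. by move=> pN; rewrite /fsize; case: ex_minnP => m _; apply; apply/asboolP. Qed.

(** The coefficient formula behind the next three lemmas. The binomial
    coefficient vanishes for [m < i], so that the truncated subtraction
    [m - i] does no harm. *)
Lemma dp_mulC_coef p a N i : (fsize p <= N)%N ->
  (p ** C a) i = \sum_(m < N) (p m ** iter (m - i) delta a) *+ 'C(m, i).
Proof.
move=> pN; rewrite [p ** C a](dp_mulE pN (fsize_mono a 0)) fcoef_sum.
apply: eq_bigr => m _; rewrite big_ord1 /= /mono_mul fcoef_sum.
have [im|mi] := leqP i m.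
  rewrite (bigD1 (Ordinal (im : (i < m.+1)%N))) //= big1 ?addr0.
    by rewrite fcoefMn /= addn0 eqxx.
  move=> j ij; rewrite fcoefMn /= addn0; case: eqP => [e|_]; last by rewrite mul0rn.
  by case/eqP: ij; apply/val_inj.
rewrite bin_small // mulr0n big1 // => j _; rewrite fcoefMn /= addn0.
case: eqP => [e|_]; last by rewrite mul0rn.
by have := ltn_ord j; rewrite -e ltnS leqNgt mi.
Qed.

Lemma dp_mulC_high p a n i : (forall i, (n < i)%N -> p i = 0) -> (n < i)%N ->
  (p ** C a) i = 0.
Proof.
move=> pn ni; rewrite (dp_mulC_coef _ _ (fsize_le pn)) big1 // => m _.
by rewrite bin_small ?mulr0n // (leq_trans (ltn_ord m)).
Qed.

Lemma dp_mulC_lead p a n : (forall i, (n < i)%N -> p i = 0) ->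
  (p ** C a) n = p n ** a.
Proof.
move=> pn; rewrite (dp_mulC_coef _ _ (fsize_le pn)) big_ord_recr /=.
rewrite subnn binn mulr1n big1 ?add0r // => m _.
by rewrite bin_small ?mulr0n.
Qed.

(** The coefficient in which [delta] first appears. If [p] commutes with [A],
    comparison with the coefficient [a ** p n] of [a p] shows that
    [(n + 1) b delta] is inner, where [b = p (n + 1)]. *)
Lemma dp_mulC_sublead p a n : (forall i, (n.+1 < i)%N -> p i = 0) ->
  (p ** C a) n = p n ** a + (p n.+1 ** delta a) *+ n.+1.
Proof.
move=> pn; rewrite (dp_mulC_coef _ _ (fsize_le pn)) !big_ord_recr /=.
rewrite subnn binn mulr1n big1 ?add0r.
  by rewrite subSnn binSn.
by move=> m _; rewrite bin_small ?mulr0n.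
Qed.

Definition dp_X : D := fmono naone 1.

(** Only the top term of [aX^m . bX^n] survives, because [delta^k b = 0] for
    [k > 0]; this applies to [b = 1] as well as to central constants. *)
Lemma mono_mul_delta0 a m b n : delta b = 0 ->
  mono_mul delta a m b n = fmono (a ** b) (m + n).
Proof.
move=> b0; rewrite /mono_mul big_ord_recr /= subnn binn mulr1n big1 ?add0r //.
move=> j _; have -> : iter (m - j) delta b = 0.
  have : (0 < m - j)%N by rewrite subn_gt0.
  by case: (m - j)%N => // k _; rewrite iterSr b0 iter_delta0.
by rewrite namul0r fmono0 mul0rn.
Qed.

Lemma X_mono_mul b n :
  mono_mul delta naone 1 b n = (fmono (delta b) n : D) + (fmono b n.+1 : D).
Proof.
by rewrite /mono_mul 2!big_ord_recl big_ord0 addr0 /= !namul1l !mulr1n.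
Qed.

(** Since [X b = b X + delta b] and [delta 1 = 0], the commutator with [X] acts
    as [delta] on each coefficient. Hence ideals of [D] are stable under the
    coefficientwise [delta], and the coefficients of any polynomial that
    commutes with [X] are killed by [delta]. *)
Lemma dp_X_commutator p i : (dp_X ** p - p ** dp_X) i = delta (p i).
Proof.
have pE : p = \sum_(m < fsize p) (fmono (p m) m : D).
  by rewrite [RHS](fpoly_sum_mono (leqnn _)).
have -> : dp_X ** p - p ** dp_X = \sum_(m < fsize p) fmono (delta (p m)) m.
  rewrite {1 2}pE namul_sumr namul_suml -sumrB; apply: eq_bigr => m _.
  rewrite /dp_X !dp_mul_mono X_mono_mul mono_mul_delta0; last exact: delta_one.
  rewrite namul1r addn1.
  exact: (addrK (fmono (p m) m.+1 : D)).
rewrite (fcoef_sum_mono (fun m => delta (p m))).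
by case: ltnP => // /fsizeP ->; rewrite raddf0.
Qed.

(** No multiple [(n + 1) b delta], with [b] a nonzero [delta]-constant, is an
    inner map [a |-> a c - c a]. This is what prevents a polynomial of positive
    degree with leading coefficient [b] from commuting with [A]. *)
Definition delta_outer : Prop := forall n b c, b <> 0 -> delta b = 0 ->
  exists a, (b ** delta a) *+ n.+1 <> a ** c - c ** a.

(** Leading coefficients of the elements of minimal degree [n] in a nonzero
    ideal form a nonzero [delta]-stable ideal of [A], hence contain [1]. A monic
    [p] of degree [n] in the ideal commutes with [A], because [a p - p a] has
    lower degree; the coefficient of [X^(n-1)] then makes [n delta] inner
    unless [n = 0], and in that case [p = 1]. *)
Theorem dp_simple :
  (forall J : set A, naideal J -> (forall a, J a -> J (delta a)) ->
     J = [set 0] \/ J naone) ->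
  delta_outer ->
  nasimple D.
Proof.
move=> dsimple outer I [I0 IB Il Ir].
have [I_le0|/existsNP[p0]] := pselect (forall p, I p -> p = 0).
  by left; apply/seteqP; split=> p; [move/I_le0 | move=> ->].
move=> /not_implyP[Ip0 p0_neq0]; right.
(* [n] will be the least degree of a nonzero element of [I]. *)
pose small n := `[< exists p : D,
  [/\ I p, p <> 0 & forall i, (n < i)%N -> p i = 0] >].
have [n /asboolP[q [Iq q_neq0 qn]] n_min] : exists2 n, small n &
    forall m, small m -> (n <= m)%N.
  have ex : exists m, small m.
    exists (fsize p0); apply/asboolP; exists p0; split=> // i /ltnW.
    exact: fsizeP.
  by exists (ex_minn ex); case: ex_minnP.
have I_small p : I p -> (forall i, (n <= i)%N -> p i = 0) -> p = 0.
  move=> Ip pn; apply: contrapT => p_neq0.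
  case: n n_min qn pn => [|n] n_min _ pn.
    by apply: p_neq0; apply/fpolyP => i; exact: pn.
  suff /n_min : small n by rewrite ltnn.
  by apply/asboolP; exists p; split.
pose J : set A := [set a | exists2 p : D,
  I p /\ (forall i, (n < i)%N -> p i = 0) & p n = a].
have J_ideal : naideal J.
  split.
  - by exists 0.
  - move=> _ _ [p [Ip pn] <-] [p' [Ip' p'n] <-]; exists (p - p') => //.
    split=> [|i ni]; first exact: IB.
    by rewrite fcoefB pn // p'n // subrr.
  - move=> a _ [p [Ip pn] <-]; exists (C a ** p); last exact: dp_Cmul_coef.
    split=> [|i ni]; first exact: Il.
    by rewrite dp_Cmul_coef pn // namul0r.
  - move=> a _ [p [Ip pn] <-]; exists (p ** C a); last exact: dp_mulC_lead.
    by split=> [|i ni]; [exact: Ir | exact: dp_mulC_high ni].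
have J_delta a : J a -> J (delta a).
  move=> [p [Ip pn] <-]; exists (dp_X ** p - p ** dp_X).
    split=> [|i ni]; first by apply: IB; [exact: Il | exact: Ir].
    by rewrite dp_X_commutator pn // raddf0.
  exact: dp_X_commutator.
have [J0|[p [Ip pn] p_lead]] := dsimple J J_ideal J_delta.
  case: q_neq0; apply: I_small => // i; rewrite leq_eqVlt => /orP[/eqP <-|].
    by have : J (q n) by [exists q]; rewrite J0.
  exact: qn.
have comm a : C a ** p = p ** C a.
  apply/subr0_eq/I_small; first by apply: IB; [exact: Il | exact: Ir].
  move=> i; rewrite leq_eqVlt fcoefB dp_Cmul_coef => /orP[/eqP <-|ni].
    by rewrite dp_mulC_lead // p_lead namul1r namul1l subrr.
  by rewrite pn // (dp_mulC_high _ pn ni) namul0r subrr.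
case: n {qn n_min I_small J J_ideal J_delta} pn p_lead => [|n] pn p_lead.
  have p1 : p = naone.
    apply/fpolyP => -[|i] /=; first exact: p_lead.
    exact: pn.
  apply/seteqP; split=> // r _; rewrite -[r]namul1r -p1.
  exact: Il.
have one_neq0 : (naone : A) <> 0.
  move=> one0; apply: q_neq0; apply/fpolyP => i.
  by rewrite -[q i]namul1l one0 namul0l.
have [a []] := outer n naone (p n) one_neq0 (delta_one delta).
rewrite namul1l.
have /fpolyP/(_ n) := comm a.
rewrite dp_Cmul_coef dp_mulC_sublead // p_lead namul1l => ->.
by rewrite addrC addKr.
Qed.

(** In degree [N + 1 > 0], the coefficient of [X^N] in [a p = p a] contradicts
    [delta_outer] for [b = p (N + 1)] and [c = p N]; commutation with [X] makes
    [b] a [delta]-constant. *)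
Lemma dp_commuting_const p : delta_outer -> (forall q, p ** q = q ** p) ->
  p = C (p 0%N) /\ delta (p 0%N) = 0.
Proof.
move=> outer comm.
have dp i : delta (p i) = 0 by rewrite -dp_X_commutator comm subrr.
have p_const i : (0 < i)%N -> p i = 0.
  suff pN N k : (forall i, (N < i)%N -> p i = 0) -> (0 < k)%N -> p k = 0.
    by apply: (pN (fsize p)) => j /ltnW; exact: fsizeP.
  elim: N => [|N IH] pN; first exact: pN.
  apply: IH => j; rewrite leq_eqVlt => /orP[/eqP <-|]; last exact: pN.
  apply: contrapT => pN_neq0.
  have [a []] := outer N (p N.+1) (p N) pN_neq0 (dp N.+1).
  have /fpolyP/(_ N) := comm (C a).
  by rewrite dp_Cmul_coef dp_mulC_sublead // => <-; rewrite addrC addKr.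
by split=> //; apply/fpolyP => -[|i] //=; exact: p_const.
Qed.

Lemma dp_constM a b : C a ** C b = C (a ** b).
Proof.
by apply/fpolyP => i; rewrite dp_Cmul_coef /=; case: ifP; rewrite ?namul0r.
Qed.

Lemma dp_const_centerI a : nacenter D (C a) -> nacenter A a.
Proof.
have C_inj : injective C by move=> b c /fpolyP/(_ 0%N).
move=> [a_comm a_assoc]; split=> [s|s t].
  by apply: C_inj; rewrite -!dp_constM.
have [al am ar] := a_assoc (C s) (C t).
by split; apply/eqP; rewrite subr_eq0; apply/eqP/C_inj; rewrite -!dp_constM;
  apply/subr0_eq.
Qed.

(** A central [c] that behaves like a scalar for [delta] can be moved through
    every iterate of [delta], and so through every product of monomials; by
    triadditivity of the associator this suffices for [c] to be central in
    [D]. *)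
Section CentralConstants.
Variable c : A.
Hypotheses (c_center : nacenter A c)
  (delta_cl : forall b, delta (c ** b) = c ** delta b)
  (delta_cr : forall b, delta (b ** c) = delta b ** c).

Let iter_cl k b : iter k delta (c ** b) = c ** iter k delta b.
Proof. by elim: k => //= k ->. Qed.

Let iter_cr k b : iter k delta (b ** c) = iter k delta b ** c.
Proof. by elim: k => //= k ->. Qed.

Let assoc_l a b : (c ** a) ** b = c ** (a ** b).
Proof. by have [_ /(_ a b)[/subr0_eq]] := c_center. Qed.

Let assoc_m a b : (a ** c) ** b = a ** (c ** b).
Proof. by have [_ /(_ a b)[_ /subr0_eq]] := c_center. Qed.

Let assoc_r a b : (a ** b) ** c = a ** (b ** c).
Proof. by have [_ /(_ a b)[_ _ /subr0_eq]] := c_center. Qed.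

Let comm a : c ** a = a ** c.
Proof. by have [+ _] := c_center. Qed.

Let deltac : delta c = 0.
Proof. by rewrite -[c]namul1r delta_cl delta_one namul0r. Qed.

Let C_mono a n : C c ** (fmono a n : D) = fmono (c ** a) n.
Proof.
apply/fpolyP => i; rewrite dp_Cmul_coef /=.
by case: ifP; rewrite ?namul0r.
Qed.

Let C_comm p : C c ** p = p ** C c.
Proof.
apply: (@dp_mono_ind (fun p => C c ** p = p ** C c)) => [x y cx cy|a m].
  by rewrite namulDr namulDl cx cy.
by rewrite C_mono dp_mul_mono mono_mul_delta0 // addn0 comm.
Qed.

Let C_mono_mul a m b n :
  C c ** mono_mul delta a m b n = mono_mul delta (c ** a) m b n.
Proof.
rewrite /mono_mul namul_sumr; apply: eq_bigr => i _.
by rewrite namulMnr C_mono assoc_l.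
Qed.

Let mono_mulC a m b n :
  mono_mul delta a m b n ** C c = mono_mul delta a m (b ** c) n.
Proof.
rewrite -C_comm /mono_mul namul_sumr; apply: eq_bigr => i _.
by rewrite namulMnr C_mono comm iter_cr assoc_r.
Qed.

Let mono_Cmono a m b n :
  mono_mul delta (a ** c) m b n = mono_mul delta a m (c ** b) n.
Proof.
by rewrite /mono_mul; apply: eq_bigr => i _; rewrite iter_cl assoc_m.
Qed.

Lemma dp_const_center : nacenter D (C c).
Proof.
split=> [|p q]; first exact: C_comm.
have indP (P : D -> D -> Prop) : (forall x y z, P x y -> P x z -> P x (y + z)) ->
    (forall x y z, P x z -> P y z -> P (x + y) z) ->
    (forall a m b n, P (fmono a m) (fmono b n)) -> P p q.
  move=> PDr PDl Pm; apply: (@dp_mono_ind (P^~ q)) => [x y|a m]; first exact: PDl.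
  by apply: (@dp_mono_ind (P _)) => [x y|b n]; [exact: PDr | exact: Pm].
split.
- apply: (indP (fun p q => associator (C c) p q = 0)).
  + by move=> x y z h k; rewrite associatorDr h k addr0.
  + by move=> x y z h k; rewrite associatorDm h k addr0.
  + by move=> a m b n; rewrite /associator C_mono !dp_mul_mono C_mono_mul subrr.
- apply: (indP (fun p q => associator p (C c) q = 0)).
  + by move=> x y z h k; rewrite associatorDr h k addr0.
  + by move=> x y z h k; rewrite associatorDl h k addr0.
  + move=> a m b n; rewrite /associator -C_comm !C_mono !dp_mul_mono.
    by rewrite comm mono_Cmono subrr.
- apply: (indP (fun p q => associator p q (C c) = 0)).
  + by move=> x y z h k; rewrite associatorDm h k addr0.
  + by move=> x y z h k; rewrite associatorDl h k addr0.
  + move=> a m b n; rewrite /associator -[(fmono b n : D) ** _]C_comm C_mono.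
    by rewrite !dp_mul_mono mono_mulC comm subrr.
Qed.

End CentralConstants.

End DiffPolyTheory.

(** * Norm and center of the Cayley-Dickson algebras *)

Section CayleyDickson.
Context (R : realType).
Local Notation CD := (cayley_dickson R).

Section Star.
Variable A : starAlgType R.

Lemma star0 : star (0 : A) = 0.
Proof. by apply: (addrI (star 0)); rewrite -starD !addr0. Qed.

Lemma star1 : star (naone : A) = naone.
Proof. by rewrite -[LHS]namul1r -[X in _ ** X]starK -starM namul1r starK. Qed.

Lemma addxx_eq0 (x : A) : x + x = 0 -> x = 0.
Proof.
by move=> /eqP; rewrite -mulr2n -scaler_nat scaler_eq0 pnatr_eq0 => /eqP.
Qed.

Definition dbl_imag : cddouble A := (0, naone).

Lemma star_imag : star dbl_imag = - dbl_imag.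
Proof. by congr (_, _) => /=; rewrite star0 oppr0. Qed.

Lemma mul_imag_eq0 (b : cddouble A) : b ** dbl_imag = 0 -> b = 0.
Proof.
case: b => b1 b2 [] /=.
rewrite star0 star1 !namul1l !namul0r sub0r addr0 => /eqP.
by rewrite oppr_eq0 => /eqP -> ->.
Qed.

(** Commutation with a purely imaginary [(i, 0)] forces [2 b i = 0] for the
    second component [b] of [(a, b)], and commutation with [(0, 1)] forces
    [a = a*]. Such an [i], with right multiplication by it injective, is
    available as soon as the algebra that is doubled is itself a double: this
    is what separates the quaternions and their successors from the complex
    numbers. *)
Lemma dbl_commuting_star (i : A) (x : cddouble A) :
  star i = - i -> (forall b, b ** i = 0 -> b = 0) ->
  (forall y, x ** y = y ** x) -> star x = x.
Proof.
case: x => a b star_i inj_i comm.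
have b0 : b = 0.
  apply/inj_i/addxx_eq0.
  have /(congr1 snd) /= := comm (i, 0).
  by rewrite star_i namulNr !namul0l add0r addr0 => {1}<-; rewrite addNr.
have /(congr1 snd) /= := comm dbl_imag.
rewrite star0 !namul0r addr0 add0r !namul1l => aE.
by congr (_, _); rewrite /= -?aE // b0 oppr0.
Qed.

End Star.

Fixpoint cd_re (n : nat) : CD n -> R :=
  if n is m.+1 then fun x : CD m.+1 => cd_re x.1 else fun x : CD 0 => x.

Fixpoint cd_normsq (n : nat) : CD n -> R :=
  if n is m.+1 then fun x : CD m.+1 => cd_normsq x.1 + cd_normsq x.2
  else fun x : CD 0 => (x : R) * x.

Lemma cd_re_scale1 n (r : R) : cd_re (r *: (naone : CD n)) = r.
Proof. by elim: n => [|n IH]; [exact: mulr1 | exact: IH]. Qed.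

Lemma cd_scale1_inj n : injective (fun r : R => r *: (naone : CD n)).
Proof. by move=> r s /(congr1 (@cd_re n)); rewrite !cd_re_scale1. Qed.

(** In the double, [(a*, -b) (a, b) = (a* a + b* b, 0)], so this
    follows by induction even where associativity and alternativity fail. It
    makes the left ideal generated by a function contain its squared norm. *)
Lemma cd_star_mul n (x : CD n) : star x ** x = cd_normsq x *: naone.
Proof.
elim: n x => [|n IH]; first by move=> x; exact/esym/mulr1.
move=> [a b]; congr (_, _) => /=.
  by rewrite namulNr opprK !IH -scalerDl.
by rewrite namulNl subrr scaler0.
Qed.

Lemma cd_normsq_ge0 n (x : CD n) : 0 <= cd_normsq x.
Proof.
elim: n x => [|n IH] x; first by rewrite /= -expr2 sqr_ge0.
by rewrite /= addr_ge0.
Qed.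

Lemma cd_normsq_eq0 n (x : CD n) : cd_normsq x = 0 -> x = 0.
Proof.
elim: n x => [|n IH]; first by move=> x /= /eqP; rewrite mulf_eq0 orbb => /eqP.
move=> [a b] /= /eqP; rewrite paddr_eq0 ?cd_normsq_ge0 //.
by move=> /andP[/eqP/IH -> /eqP/IH ->].
Qed.

Lemma cd_normsq_continuous n : continuous (@cd_normsq n).
Proof.
elim: n => [|n IH] x; first by apply: cvgM; exact: cvg_id.
apply: cvgD.
  apply: (@continuous_cvg _ _ _ _ _ fst (@cd_normsq n)); first exact: IH.
  exact: cvg_fst.
apply: (@continuous_cvg _ _ _ _ _ snd (@cd_normsq n)); first exact: IH.
exact: cvg_snd.
Qed.

(** The involution negates the second half of each double, so in characteristic
    zero its fixed points have only a real component. *)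
Lemma cd_star_fixed n (x : CD n) : star x = x -> x = cd_re x *: naone.
Proof.
elim: n x => [|n IH]; first by move=> x _; exact/esym/mulr1.
move=> [a b] [/IH aE bE]; congr (_, _) => //=.
by rewrite scaler0; apply: addxx_eq0; rewrite -{1}bE addNr.
Qed.

Lemma scale1_center n (r : R) : nacenter (CD n) (r *: naone).
Proof.
split=> [s|s t]; first by rewrite namulZl namulZr namul1l namul1r.
by split; rewrite /associator !(namulZl, namulZr, namul1l, namul1r) subrr.
Qed.

Lemma complex_center (x : CD 1) : nacenter (CD 1) x.
Proof.
have realM (a b : CD 0) : a ** b = (a : R) * b by [].
have comm (u v : CD 1) : u ** v = v ** u.
  case: u v => [a b] [c d]; congr (_, _) => /=; rewrite !realM.
    by congr (_ - _); exact: mulrC.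
  by rewrite addrC; congr (_ + _); exact: mulrC.
have assoc (u v w : CD 1) : (u ** v) ** w = u ** (v ** w).
  case: u v w => [a b] [c d] [e f]; congr (_, _) => /=; rewrite !realM /star /=.
    by rewrite !(mulrDl, mulrDr, mulrBl, mulrBr); ring.
  ring.
by split=> [y|y z]; [exact: comm | split; rewrite /associator assoc subrr].
Qed.

Lemma cd_commuting_real n (x : CD n.+2) : (forall y, x ** y = y ** x) ->
  x = cd_re x *: naone.
Proof.
move=> comm; apply: cd_star_fixed.
exact: dbl_commuting_star (star_imag _) (@mul_imag_eq0 _) comm.
Qed.

Lemma cd_center1 n : n = 1%N -> nacenter (CD n) = setT.
Proof. by move=> ->; apply/seteqP; split=> // x _; exact: complex_center. Qed.

Lemma cd_center_neq1 n : n <> 1%N ->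
  nacenter (CD n) = range (fun r : R => r *: (naone : CD n)).
Proof.
move=> n1; apply/seteqP; split=> [x [x_comm _]|_ [r _ <-]]; last first.
  exact: scale1_center.
exists (cd_re x) => //; case: n n1 x x_comm => [|[|n]] // _ x x_comm.
  exact: mulr1.
exact/esym/cd_commuting_real.
Qed.

End CayleyDickson.

(** * Continuous functions and their ideals *)

Section ContinuousFunctions.
Context (R : realType) (n : nat) (Y : topologicalType).
Local Notation K := (cayley_dickson R n).
Local Notation CY := (continuousType Y K).
Implicit Types (f h : CY) (y : Y).

Lemma scale1_continuous (r : Y -> R) : continuous r ->
  continuous (fun y => r y *: (naone : K)).
Proof. by move=> r_cts y; apply: cvgZr_tmp; exact: r_cts. Qed.

Definition real_cts (r : Y -> R) (r_cts : continuous r) : CY :=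
  mkcts (scale1_continuous r_cts).

Lemma real_cts_comm (r : Y -> R) (r_cts : continuous r) f :
  real_cts r_cts ** f = f ** real_cts r_cts.
Proof.
apply/continuousEP => y.
transitivity ((r y *: naone) ** f y); first by [].
transitivity (f y ** (r y *: naone)); last by [].
by rewrite namulZl namulZr namul1l namul1r.
Qed.

Lemma star_cts f : continuous (fun y => star (f y)).
Proof.
by move=> y; apply: continuous_cvg; [exact: star_continuous | exact: cts_fun].
Qed.

Definition cts_star f : CY := mkcts (@star_cts f).

Lemma cts_star_mul f y : (cts_star f ** f) y = cd_normsq (f y) *: naone.
Proof. exact: cd_star_mul. Qed.

Lemma normsq_cts f : continuous (fun y => cd_normsq (f y)).
Proof.
move=> y; apply: continuous_cvg; first exact: cd_normsq_continuous.
exact: cts_fun.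
Qed.

Lemma zeros_closed f : closed [set y | f y = 0].
Proof.
apply: (@preimage_closed _ _ f [set 0]) => [y _|]; first exact: cts_fun.
exact/accessible_closed_set1/hausdorff_accessible/norm_hausdorff.
Qed.

(** The factor [h] is the inverse of the squared norm of [f]. The product is
    bracketed so that membership of [f] in an ideal passes to [1]. *)
Lemma nonvanishing_generates_one f : (forall y, f y <> 0) ->
  exists h, h ** (cts_star f ** f) = naone.
Proof.
move=> f_neq0.
have N_neq0 y : cd_normsq (f y) != 0.
  by apply/eqP => /cd_normsq_eq0/f_neq0.
have inv_cts : continuous (fun y => (cd_normsq (f y))^-1).
  by move=> y; apply: cvgV => //; exact: normsq_cts.
exists (real_cts inv_cts); apply/continuousEP => y.
transitivity (((cd_normsq (f y))^-1 *: naone) ** (cts_star f ** f) y).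
  by [].
by rewrite cts_star_mul namulZl namul1l scalerA mulVf // scale1r.
Qed.

(** A weak Nullstellensatz. As [J] is proper and a nowhere vanishing function
    generates [1], the zero sets of elements of [J] are nonempty, and the zero set of
    [f* f + h* h] is the intersection of those of [f] and [h]. So they form a
    filter base of closed sets, and a cluster point lies in all of them. *)
Lemma proper_ideal_zero (J : set CY) : compact [set: Y] -> naideal J ->
  ~ J naone -> exists y, forall f, J f -> f y = 0.
Proof.
move=> Yc [J0 JB Jl _] J1.
have JD f h : J f -> J h -> J (f + h).
  move=> Jf Jh; have -> : f + h = f - (0 - h) by rewrite sub0r opprK.
  by apply: (JB) => //; exact: JB.
pose F : set_system Y :=
  [set S | exists2 f, J f & [set y | f y = 0] `<=` S].
have FF : ProperFilter F.
  apply: Build_ProperFilter_ex.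
    move=> S [f Jf fS]; apply: contrapT => /forallNP S0.
    have [|h hE] := @nonvanishing_generates_one f.
      by move=> y fy0; apply: (S0 y); exact: fS.
    by apply: J1; rewrite -hE; apply: (Jl); exact: Jl.
  split=> [|S T [f Jf fS] [h Jh hT]|S T ST [f Jf fS]].
  - by exists 0.
  - exists (cts_star f ** f + cts_star h ** h); first by apply: JD; exact: Jl.
    move=> y /= fhy.
    have : cd_normsq (f y) + cd_normsq (h y) = 0.
      apply: (@cd_scale1_inj R n); rewrite scalerDl -!cts_star_mul scale0r.
      exact: fhy.
    move=> /eqP; rewrite paddr_eq0 ?cd_normsq_ge0 // => /andP[/eqP fy0 /eqP hy0].
    by split; [apply: fS | apply: hT]; exact: cd_normsq_eq0.
  - by exists f => //; exact: subset_trans ST.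
have [y [_]] := Yc F FF (ex_intro2 _ _ 0 J0 (fun _ _ => I)).
rewrite clusterE => Fy; exists y => f Jf.
by apply: (@zeros_closed f); apply: Fy; exists f.
Qed.

Lemma cts_const_center (c : K) : nacenter K c -> nacenter CY (cst c).
Proof.
move=> [c_comm c_assoc]; split=> [f|f h].
  by apply/continuousEP => y; exact: c_comm.
by split; apply/continuousEP => y; have [] := c_assoc (f y) (h y).
Qed.

Lemma cts_const_centerI (c : K) (y : Y) : nacenter CY (cst c) -> nacenter K c.
Proof.
move=> [c_comm c_assoc]; split=> [s|s t].
  by have /continuousEP/(_ y) := c_comm (cst s).
have [cl cm cr] := c_assoc (cst s) (cst t).
by split; [move/continuousEP/(_ y): cl | move/continuousEP/(_ y): cm |
  move/continuousEP/(_ y): cr].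
Qed.

End ContinuousFunctions.

(** * Minimal actions *)

Section Minimality.
Context (R : realType) (n : nat) (Y : topologicalType) (g : continuousType Y Y).
Local Notation K := (cayley_dickson R n).
Local Notation CY := (continuousType Y K).
Local Notation delta := (delta_sigma K g).
Hypothesis g_min : minimal_action g.

Lemma delta_sigmaE (f : CY) y : delta f y = f (g y) - f y.
Proof. by []. Qed.

(** A [delta]-stable ideal is stable under [f |-> f \o g], so its set of common
    zeros is closed and [g]-invariant. If the ideal is proper, this set is not
    empty, hence it is [Y] and the ideal is zero. *)
Lemma minimal_delta_simple (J : set CY) : compact [set: Y] -> naideal J ->
  (forall f, J f -> J (delta f)) -> J = [set 0] \/ J naone.
Proof.
move=> Yc J_ideal J_delta; have [J1|J1] := pselect (J naone); first by right.
have [y0 y0Z] := proper_ideal_zero Yc J_ideal J1.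
left; pose Z := \bigcap_(f in J) [set y | f y = 0].
have [||Z0|ZT] := g_min (Z := Z).
- by apply: closed_bigI => f _; exact: zeros_closed.
- move=> _ [y Zy <-] f Jf; have /eqP := Zy _ (J_delta f Jf).
  by rewrite delta_sigmaE (Zy f Jf) subr0 => /eqP.
- have : Z y0 by move=> f /y0Z.
  by rewrite Z0.
- apply/seteqP; split=> [f Jf|_ ->]; last by case: J_ideal.
  apply/continuousEP => y; have : Z y by rewrite ZT.
  exact.
Qed.

Lemma minimal_fixed_const (f : CY) (y0 : Y) : delta f = 0 -> f = cst (f y0).
Proof.
move=> /continuousEP f_fix; apply/continuousEP => y.
have [||Z0|ZT] := g_min (Z := [set y | f y = f y0]).
- apply: (@preimage_closed _ _ f [set f y0]) => [z _|]; first exact: cts_fun.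
  exact/accessible_closed_set1/hausdorff_accessible/norm_hausdorff.
- move=> _ [z /= <- <-]; apply/subr0_eq; exact: f_fix.
- by have : [set y | f y = f y0] y0 by []; rewrite Z0.
- by have : [set y | f y = f y0] y by rewrite ZT.
Qed.

(** If [g] were the identity, every singleton would be invariant, and minimality
    would leave a single, isolated, point. *)
Lemma minimal_moves_point : hausdorff_space Y -> ~ discrete_space Y ->
  exists y, g y <> y.
Proof.
move=> Yh Ynd; apply: contrapT => /forallNP g_id; apply: Ynd => U.
have [->|/set0P[y Uy]] := eqVneq U set0; first exact: open0.
suff -> : U = setT by exact: openT.
have [||y0|yT] := g_min (Z := [set y]).
- exact/accessible_closed_set1/hausdorff_accessible.
- by move=> _ [_ -> <-]; exact: contrapT (g_id y).
- by have : [set y] y by []; rewrite y0.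
- by apply/seteqP; split=> // z _; have : [set y] z by [rewrite yT]; move=> ->.
Qed.

(** Real-valued functions commute with everything, and Urysohn's lemma provides
    one that takes the values [0] at [y] and [1] at [g y] for some [y]. Any
    inner map vanishes on it, while [(m + 1) b delta] takes the value
    [(m + 1) b] at [y], and the [delta]-constant [b] is a nonzero constant
    function. *)
Lemma minimal_delta_outer : compact [set: Y] -> hausdorff_space Y ->
  ~ discrete_space Y -> delta_outer delta.
Proof.
move=> Yc Yh Ynd m b c b_neq0 b_fix.
have [y gy] := minimal_moves_point Yh Ynd.
have cl1 (z : Y) : closed [set z].
  exact/accessible_closed_set1/hausdorff_accessible.
have := (@normal_separatorP R Y).1 (compact_normal Yh Yc) _ _ (cl1 y) (cl1 (g y)).
have yg0 : [set y] `&` [set g y] = set0.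
  by apply/seteqP; split=> // z [/= ->] /esym.
move=> /(_ yg0)/(@uniform_separatorP _ R)[r [r_cts _ ry rgy]].
exists (real_cts n r_cts) => /continuousEP/(_ y).
rewrite real_cts_comm subrr -[RHS]/(0 : K) => e.
have {}ry : r y = 0 by apply: ry; exists y.
have {}rgy : r (g y) = 1 by apply: rgy; exists (g y).
apply: b_neq0; rewrite (minimal_fixed_const y b_fix).
apply/continuousEP => z; rewrite -[LHS]/(b y) -[RHS]/(0 : K).
(* Evaluation at [y] commutes with taking multiples. *)
have {}e : (b y ** delta (real_cts n r_cts) y) *+ m.+1 = 0.
  rewrite -[RHS]e; elim: m {e} => // m IH.
  by rewrite mulrS IH.
move: e; rewrite delta_sigmaE.
rewrite -[real_cts _ _ y]/(r y *: naone) -[real_cts _ _ (g y)]/(r (g y) *: naone).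
rewrite ry rgy scale0r subr0 scale1r namul1r => /eqP.
by rewrite -scaler_nat scaler_eq0 pnatr_eq0 => /eqP.
Qed.

(** A central polynomial is a [g]-invariant function, hence constant by
    minimality; conversely [delta] is linear over constant functions. So the
    center of [D] is that of the algebra of values. *)
Lemma minimal_center : compact [set: Y] -> hausdorff_space Y ->
  ~ discrete_space Y ->
  nacenter (diffpoly delta) = (fun c : K => dp_const delta (cst c)) @` nacenter K.
Proof.
move=> Yc Yh Ynd; have [y0 _] := minimal_moves_point Yh Ynd.
apply/seteqP; split=> [p p_center|_ [c c_center <-]].
  have [p_comm _] := p_center.
  have [pE p_fix] := dp_commuting_const (minimal_delta_outer Yc Yh Ynd) p_comm.
  have fE := minimal_fixed_const y0 p_fix.
  exists (p 0%N y0); last by rewrite -fE -pE.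
  have : nacenter (diffpoly delta) (dp_const delta (cst (p 0%N y0))).
    by rewrite -fE -pE.
  by move/dp_const_centerI; exact: cts_const_centerI y0.
apply: dp_const_center; first exact: cts_const_center.
  move=> f; apply/continuousEP => y; rewrite delta_sigmaE.
  transitivity (c ** (f (g y) - f y)); last by [].
  by rewrite namulDr namulNr.
move=> f; apply/continuousEP => y; rewrite delta_sigmaE.
transitivity ((f (g y) - f y) ** c); last by [].
by rewrite namulDl namulNl.
Qed.

End Minimality.

Theorem theorem40 (R : realType) (n : nat) (Y : topologicalType)
    (g : continuousType Y Y)
    (K := cayley_dickson R n)
    (D := diffpoly (delta_sigma K g))
    (incl := fun c : K => dp_const (delta_sigma K g) (cst c)) :
  compact [set: Y] -> hausdorff_space Y ->
  minimal_action g -> ~ discrete_space Y ->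
  [/\ nasimple D,
      n = 1%N -> nacenter D = range incl &
      n <> 1%N -> nacenter D = range (fun r : R => incl (r *: naone))].
Proof.
move=> Yc Yh g_min Ynd.
have ZD : nacenter D = incl @` nacenter K by exact: minimal_center.
split=> [|n1|n1].
- apply: dp_simple; last exact: (minimal_delta_outer g_min Yc Yh Ynd).
  by move=> J; exact: (minimal_delta_simple g_min Yc).
- by rewrite ZD /K cd_center1.
- by rewrite ZD cd_center_neq1 // image_comp.
Qed.
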